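(* Let $\mathcal{C}$ be a class of ontologies. If $\textsc{cert-eval}[\mathcal{C}]$ is decidable, then $\textsc{dp-cert-eval}[\mathcal{C}]$ is decidable.
   Context: Standard setting: atoms, databases, TGDs $\sigma:\Phi(\mathbf{x},\mathbf{y})\to\exists\mathbf{z}\,\Psi(\mathbf{x},\mathbf{z})$, ontologies (finite sets of TGDs), datalog rules (no existential variables, single head atom), CQs, certain answers $\mathrm{cert}(q,D,\Sigma)=\bigcap\{q(M):M\supseteq D \text{ model of }\Sigma\}$. $\textsc{cert-eval}[\mathcal{C}]$: given database $D$, $\Sigma\in\mathcal{C}$, CQ $q(\mathbf{x})$, constant tuple $\mathbf{c}$, decide $\mathbf{c}\in\mathrm{cert}(q,D,\Sigma)$. For existential variable $z$, a position $\pi$ is $z$-affected if some rule has $z$ in its head at $\pi$, or some rule has a frontier variable in its head at $\pi$ occurring in its body only at $z$-affected positions; $\mathrm{aff}(\pi)$ is the set of such $z$; a body variable at positions $\pi_1,\dots,\pi_n$ is harmless if $\bigcap_i\mathrm{aff}(\pi_i)=\emptyset$. $\Sigma'\subseteq\Sigma$ is head-ground w.r.t. $\Sigma$ if (1) it consists of datalog rules; (2) its head atoms contain only variables harmless w.r.t. $\Sigma$; (3) no head predicate of $\Sigma'$ occurs in a body of $\Sigma'$; (4) no head predicate of $\Sigma'$ occurs in a head of $\Sigma\setminus\Sigma'$. A pair $\Pi=(\Sigma_{hg},\Sigma_{\mathcal{C}})$ is $\mathcal{C}$-dyadic if $\Sigma_{hg}$ is head-ground w.r.t. $\Sigma_{hg}\cup\Sigma_{\mathcal{C}}$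 and $\Sigma_{\mathcal{C}}\in\mathcal{C}$. $\textsc{dp-cert-eval}[\mathcal{C}]$: given a database $D$, a $\mathcal{C}$-dyadic pair $\Pi=(\Sigma_{hg},\Sigma_{\mathcal{C}})$, a CQ $q(\mathbf{x})$ and $\mathbf{c}\in\mathsf{C}^{|\mathbf{x}|}$, decide whether $\mathbf{c}\in\mathrm{cert}(q,D,\Sigma_{hg}\cup\Sigma_{\mathcal{C}})$. *)

(* Defs.v *)
From HB Require Import structures.
From mathcomp Require Import all_boot.

Set Implicit Arguments.
Unset Strict Implicit.
Unset Printing Implicit Defensive.

Inductive rec : Type :=
| RZero
| RSucc
| RProj of nat
| RComp of rec & seq rec
| RPrec of rec & rec
| RMu of rec.

Inductive eval : rec -> seq nat -> nat -> Prop :=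
| ev_zero v : eval RZero v 0
| ev_succ x v : eval RSucc (x :: v) x.+1
| ev_proj i v : i < size v -> eval (RProj i) v (nth 0 v i)
| ev_comp f gs v ws y : evalL gs v ws -> eval f ws y -> eval (RComp f gs) v y
| ev_prec0 g h v y : eval g v y -> eval (RPrec g h) (0 :: v) y
| ev_precS g h n v r y :
    eval (RPrec g h) (n :: v) r -> eval h (n :: r :: v) y ->
    eval (RPrec g h) (n.+1 :: v) y
| ev_mu f v n :
    eval f (n :: v) 0 ->
    (forall m, m < n -> exists k, eval f (m :: v) k.+1) ->
    eval (RMu f) v n
with evalL : seq rec -> seq nat -> seq nat -> Prop :=
| evL_nil v : evalL [::] v [::]
| evL_cons g gs v y ys : eval g v y -> evalL gs v ys -> evalL (g :: gs) v (y :: ys).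

(* A (promise) problem on a countable input type T, with domain of valid
   instances [Dom] and yes-instances [P], is decidable if some mu-recursive
   program, run on the standard encoding [pickle x] of any valid instance x,
   halts with output 1 if [P x] and 0 otherwise. *)
Definition decidable_on (T : countType) (Dom P : T -> Prop) : Prop :=
  exists e : rec, forall x : T, Dom x ->
    (P x -> eval e [:: pickle x] 1) /\ (~ P x -> eval e [:: pickle x] 0).

(* Syntax.  Predicate symbols, constants, variables and nulls are nats. *)
(* A predicate is identified by its name together with its arity.      *)

(* atom over variables: (predicate name, argument variables) *)
Definition atom := (nat * seq nat)%type.
(* TGD  Phi(x,y) -> exists z Psi(x,z) : (body atoms, head atoms) *)
Definition tgd := (seq atom * seq atom)%type.
Definition ontology := seq tgd.
(* CQ q(x) = exists y phi(x,y) : (answer variables x, body atoms phi) *)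
Definition cq := (seq nat * seq atom)%type.
(* database: finite set of facts over constants *)
Definition fact := (nat * seq nat)%type.
Definition database := seq fact.
(* domain elements of instances: constants (inl c) and labelled nulls (inr n) *)
Definition value := (nat + nat)%type.
Definition instance := (nat * seq value) -> Prop.

Definition pred_of (a : atom) : nat * nat := (a.1, size a.2).
Definition position := ((nat * nat) * nat)%type.

Definition vars_of (As : seq atom) : seq nat := flatten (map snd As).

Definition inst_atom (h : nat -> value) (a : atom) : nat * seq value :=
  (a.1, map h a.2).

Definition wf_tgd (s : tgd) : Prop := s.1 != [::] /\ s.2 != [::].
Definition wf_ontology (S : ontology) : Prop := forall s, s \in S -> wf_tgd s.

Definition satisfies (M : instance) (s : tgd) : Prop :=
  forall h : nat -> value, (forall a, a \in s.1 -> M (inst_atom h a)) ->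
  exists h' : nat -> value,
    (forall x, x \in vars_of s.1 -> h' x = h x) /\
    (forall a, a \in s.2 -> M (inst_atom h' a)).

Definition is_model (M : instance) (S : ontology) : Prop :=
  forall s, s \in S -> satisfies M s.

Definition contains_db (M : instance) (D : database) : Prop :=
  forall f, f \in D -> M (f.1, map (@inl nat nat) f.2).

Definition answer (q : cq) (M : instance) (c : seq nat) : Prop :=
  exists h : nat -> value,
    (forall a, a \in q.2 -> M (inst_atom h a)) /\
    map h q.1 = map (@inl nat nat) c.

Definition cert (q : cq) (D : database) (S : ontology) (c : seq nat) : Prop :=
  forall M : instance, contains_db M D -> is_model M S -> answer q M c.

Definition occurs_at (As : seq atom) (x : nat) (p : position) : Prop :=
  exists2 a, a \in As &
    exists i, [/\ i < size a.2, nth 0 a.2 i = x & p = (pred_of a, i)].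

Definition existential_var (s : tgd) (z : nat) : Prop :=
  z \in vars_of s.2 /\ z \notin vars_of s.1.

Definition frontier_var (s : tgd) (x : nat) : Prop :=
  x \in vars_of s.2 /\ x \in vars_of s.1.

(* An existential variable is identified by its rule s and its name z.
   [affected S s z p]: position p is (s,z)-affected w.r.t. S
   (least set closed under the two clauses of the definition). *)
Inductive affected (S : ontology) (s : tgd) (z : nat) : position -> Prop :=
| aff_base p :
    s \in S -> existential_var s z -> occurs_at s.2 z p -> affected S s z p
| aff_step (s' : tgd) (x : nat) p :
    s' \in S -> frontier_var s' x -> occurs_at s'.2 x p ->
    (forall p', occurs_at s'.1 x p' -> affected S s z p') ->
    affected S s z p.

(* body variable x of rule s is harmless w.r.t. S: the intersection of
   aff(pi) over the body positions pi of x in s is empty *)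
Definition harmless (S : ontology) (s : tgd) (x : nat) : Prop :=
  ~ (exists (s0 : tgd) (z : nat),
        forall p, occurs_at s.1 x p -> affected S s0 z p).

Definition datalog_rule (s : tgd) : Prop :=
  wf_tgd s /\ exists a : atom, s.2 = [:: a] /\ (forall x, x \in a.2 -> x \in vars_of s.1).

Definition head_ground (S' S : ontology) : Prop :=
  [/\ (forall s, s \in S' -> datalog_rule s),
      (forall s x, s \in S' -> x \in vars_of s.2 -> harmless S s x),
      (forall s s' a a', s \in S' -> s' \in S' -> a \in s.2 -> a' \in s'.1 ->
          pred_of a <> pred_of a') &
      (forall s s' a a', s \in S' -> s' \in S -> s' \notin S' ->
          a \in s.2 -> a' \in s'.2 -> pred_of a <> pred_of a')].

Definition dyadic (C : ontology -> Prop) (P : ontology * ontology) : Prop :=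
  head_ground P.1 (P.1 ++ P.2) /\ C P.2.

Definition cert_input := (database * ontology * cq * seq nat)%type.

Definition cert_eval_dom (C : ontology -> Prop) (x : cert_input) : Prop :=
  let: (D, Sg, q, c) := x in C Sg /\ size c = size q.1.
Definition cert_eval_yes (x : cert_input) : Prop :=
  let: (D, Sg, q, c) := x in cert q D Sg c.

Definition dp_input := (database * (ontology * ontology) * cq * seq nat)%type.

Definition dp_cert_eval_dom (C : ontology -> Prop) (x : dp_input) : Prop :=
  let: (D, P, q, c) := x in dyadic C P /\ size c = size q.1.
Definition dp_cert_eval_yes (x : dp_input) : Prop :=
  let: (D, P, q, c) := x in cert q D (P.1 ++ P.2) c.

(* Main.v *)
Require Import Defs.
From mathcomp Require Import all_boot.
From Stdlib Require Import ClassicalEpsilon.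

Set Implicit Arguments.
Unset Strict Implicit.
Unset Printing Implicit Defensive.

(* Let K be the least set of facts over the constants of D that contains, for
   each head-ground rule, every instance of its head whose body is a certain
   answer over D and K for the remaining rules.  There are finitely many
   candidate facts and membership is a certain-answer question for Sigma_C, so K
   is computed by calling the given decision procedure in rounds, and it remains
   to see that Sigma_hg and Sigma_C entail the same answers over D as Sigma_C
   over D and K.  For this, take the skolem chase of D and K under Sigma_C.  A
   null invented for an existential variable z only appears at z-affected
   positions, so a match of the body of a head-ground rule sends the harmless
   head variables to constants of D; since the chase is universal the head
   instance is already in K.  The chase is therefore a model of all rules, and
   its answers map to every model of Sigma_C over D and K.  Programs handle
   encoded data through [code_cons], the list constructor of [CodeSeq.code] on
   which the encodings of pairs and sequences are built. *)

(** * Basic mu-recursive programs *)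

Definition comp1 f g := RComp f [:: g].
Definition comp2 f g h := RComp f [:: g; h].

Lemma eval_comp1 f g v y z :
  eval g v y -> eval f [:: y] z -> eval (comp1 f g) v z.
Proof. by move=> gy; apply: ev_comp; apply: evL_cons (evL_nil _). Qed.

Lemma eval_comp2 f g h v x y z :
  eval g v x -> eval h v y -> eval f [:: x; y] z -> eval (comp2 f g h) v z.
Proof.
by move=> gx hy; apply: ev_comp; apply: evL_cons gx (evL_cons hy (evL_nil _)).
Qed.

Lemma eval_proj0 x v : eval (RProj 0) (x :: v) x.
Proof. exact: (@ev_proj 0 (x :: v)). Qed.

Lemma eval_proj1 x y v : eval (RProj 1) [:: x, y & v] y.
Proof. exact: (@ev_proj 1 [:: x, y & v]). Qed.

Lemma eval_proj2 x y z v : eval (RProj 2) [:: x, y, z & v] z.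
Proof. exact: (@ev_proj 2 [:: x, y, z & v]). Qed.

Fixpoint rnum n := if n is m.+1 then comp1 RSucc (rnum m) else RZero.

Lemma eval_num n v : eval (rnum n) v n.
Proof.
by elim: n => [|n IHn]; [exact: ev_zero | exact: eval_comp1 IHn (ev_succ _ _)].
Qed.

Definition rnot := RPrec (rnum 1) RZero.

Lemma eval_not (b : bool) v : eval rnot ((b : nat) :: v) (~~ b).
Proof.
case: b; last exact/ev_prec0/eval_num.
by apply: ev_precS (ev_zero _); apply/ev_prec0/eval_num.
Qed.

Definition rodd := RPrec RZero (comp1 rnot (RProj 1)).

Lemma eval_odd n v : eval rodd (n :: v) (odd n).
Proof.
elim: n => [|n IHn]; first exact/ev_prec0/ev_zero.
exact: ev_precS IHn (eval_comp1 (eval_proj1 _ _ _) (eval_not _ _)).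
Qed.

Definition riter f := RPrec (RProj 0) (comp1 f (RProj 1)).

Lemma eval_iter r f n x v :
  (forall y, eval r [:: y] (f y)) -> eval (riter r) [:: n, x & v] (iter n f x).
Proof.
move=> rf; elim: n => [|n IHn]; first exact/ev_prec0/eval_proj0.
exact: ev_precS IHn (eval_comp1 (eval_proj1 _ _ _) (rf _)).
Qed.

Definition radd := riter RSucc.

Lemma eval_add m n v : eval radd [:: m, n & v] (m + n).
Proof.
have -> : m + n = iter m succn n by elim: m => // m IHm; rewrite addSn IHm.
by apply: eval_iter => y; apply: ev_succ.
Qed.

Definition rdouble := comp2 radd (RProj 0) (RProj 0).

Lemma eval_double n v : eval rdouble (n :: v) n.*2.
Proof.
by rewrite -addnn; apply: eval_comp2 (eval_add _ _ _); apply: eval_proj0.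
Qed.

Definition rhalf := RPrec RZero (comp2 radd (comp1 rodd (RProj 0)) (RProj 1)).

Lemma eval_half n v : eval rhalf (n :: v) n./2.
Proof.
elim: n => [|n IHn]; first exact/ev_prec0/ev_zero.
rewrite -[n.+1./2]/(uphalf n) uphalf_half; apply: ev_precS IHn _.
apply: eval_comp2 (eval_add _ _ _); last exact: eval_proj1.
exact: eval_comp1 (eval_proj0 _ _) (eval_odd _ _).
Qed.

(** * The list constructor of the encoding and its projections *)

Definition code_cons x y := 2 ^ x * y.*2.+1.

Lemma code_consE x y : code_cons x y = iter x double y.*2.+1.
Proof.
rewrite /code_cons; elim: x => [|x IHx]; first by rewrite mul1n.
by rewrite expnS -mulnA IHx mul2n iterS.
Qed.

Lemma iter_half_code k x y :
  k <= x -> iter k half (code_cons x y) = code_cons (x - k) y.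
Proof.
elim: k => [|k IHk] lt_kx; first by rewrite subn0.
rewrite iterS IHk 1?ltnW // -[in x - k](subnSK lt_kx) /code_cons expnS -mulnA.
by rewrite mul2n doubleK.
Qed.

Lemma code_cons_gt x y : y < code_cons x y.
Proof.
apply: leq_trans (leq_pmull _ _); last by rewrite expn_gt0.
by rewrite ltnS -addnn leq_addr.
Qed.

Definition rcode_cons := comp2 (riter rdouble) (RProj 0)
  (comp1 RSucc (comp1 rdouble (RProj 1))).

Lemma eval_code_cons x y v : eval rcode_cons [:: x, y & v] (code_cons x y).
Proof.
rewrite code_consE; apply: eval_comp2 (eval_proj0 _ _) _ _.
  apply: eval_comp1 (ev_succ _ _).
  exact: eval_comp1 (eval_proj1 _ _ _) (eval_double _ _).
by apply: eval_iter => n; apply: eval_double.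
Qed.

(** The head is the 2-adic valuation of the code: the least number of halvings that make it odd. *)
Definition rcode_head :=
  RMu (comp1 rnot (comp1 rodd (comp2 (riter rhalf) (RProj 0) (RProj 1)))).

Lemma eval_code_head x y v : eval rcode_head (code_cons x y :: v) x.
Proof.
pose b k := ~~ odd (iter k half (code_cons x y)).
have evb k : eval (comp1 rnot (comp1 rodd (comp2 (riter rhalf) (RProj 0)
    (RProj 1)))) [:: k, code_cons x y & v] (b k).
  apply: eval_comp1 (eval_not _ _); apply: eval_comp1 (eval_odd _ _).
  apply: eval_comp2 (eval_proj0 _ _) (eval_proj1 _ _ _) _.
  by apply: eval_iter => n; apply: eval_half.
apply: ev_mu => [|m lt_mx].
  suff b0 : b x = false by have := evb x; rewrite b0.
  by rewrite /b iter_half_code // subnn /code_cons mul1n /= odd_double.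
exists 0; suff b1 : b m = true by have := evb m; rewrite b1.
rewrite /b iter_half_code 1?ltnW // /code_cons oddM oddX /=.
by rewrite odd_double andbT orbF subn_eq0 leqNgt lt_mx.
Qed.

Definition rcode_tail := comp1 rhalf (comp2 (riter rhalf) rcode_head (RProj 0)).

Lemma eval_code_tail x y v : eval rcode_tail (code_cons x y :: v) y.
Proof.
have {2}-> : y = (iter x half (code_cons x y))./2.
  rewrite iter_half_code // subnn /code_cons mul1n.
  by rewrite -[_.+1./2]/(uphalf _) uphalf_double.
apply: eval_comp1 (eval_half _ _).
apply: eval_comp2 (eval_code_head _ _ _) (eval_proj0 _ _) _.
by apply: eval_iter => n; apply: eval_half.
Qed.

(* Unlike a composition, [RPrec] leaves [b], which may diverge when [t] is 0,
   unevaluated in that case. *)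
Definition rifz t a b :=
  RComp (RPrec (RProj 1) (comp1 b (RProj 2)))
    [:: comp1 (RPrec RZero (rnum 1)) t; RProj 0; a].

Lemma eval_ifz t a b x n y z :
  eval t [:: x] n -> eval a [:: x] y -> (n != 0 -> eval b [:: x] z) ->
  eval (rifz t a b) [:: x] (if n == 0 then y else z).
Proof.
move=> tn ay bz.
apply: (@ev_comp _ _ _ [:: (n != 0) : nat; x; y]).
  apply: evL_cons; last first.
    by apply: evL_cons (eval_proj0 _ _) (evL_cons ay (evL_nil _)).
  apply: eval_comp1 tn _; case: n {bz} => [|n]; first exact/ev_prec0/ev_zero.
  elim: n => [|n IHn]; apply: ev_precS (eval_num _ _); last exact: IHn.
  exact/ev_prec0/ev_zero.
case: n bz {tn} => [|n] bz /=; first exact/ev_prec0/eval_proj1.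
apply: (@ev_precS _ _ _ _ y); first exact/ev_prec0/eval_proj1.
by apply: eval_comp1 (bz isT); apply: eval_proj2.
Qed.

(** * Computable functions on encoded data *)

(** [P] is a promise: the program may fail or diverge outside it. The given decision procedure is
    only available on such terms. *)
Definition computable (A B : countType) (P : A -> Prop) (f : A -> B) : Prop :=
  exists r, forall a, P a -> eval r [:: pickle a] (pickle (f a)).

Lemma pickle_pair (A B : countType) (a : A) (b : B) :
  pickle (a, b) = code_cons (pickle a) (code_cons (pickle b) 0).
Proof. by []. Qed.

Lemma pickle_cons (A : countType) (x : A) s :
  pickle (x :: s) = code_cons (pickle x) (pickle s).
Proof. by []. Qed.

(** Lets a loop over a list use the code of the list as its number of rounds. *)
Lemma size_leq_pickle (A : countType) (s : seq A) : size s <= pickle s.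
Proof.
elim: s => // x s IHs; rewrite pickle_cons.
exact: leq_ltn_trans IHs (code_cons_gt _ _).
Qed.

Section Computable.
Context {A : countType} {P : A -> Prop}.

Lemma computable_id : computable P id.
Proof. by exists (RProj 0) => a _; apply: eval_proj0. Qed.

Lemma computable_const (B : countType) (b : B) : computable P (fun=> b).
Proof. by exists (rnum (pickle b)) => a _; apply: eval_num. Qed.

Lemma computable_comp (B C : countType) (Q : B -> Prop) (g : B -> C)
    (f : A -> B) :
  computable Q g -> computable P f -> (forall a, P a -> Q (f a)) ->
  computable P (g \o f).
Proof.
move=> [rg gP] [rf fP] PQ; exists (comp1 rg rf) => a Pa.
exact: eval_comp1 (fP a Pa) (gP _ (PQ a Pa)).
Qed.

Lemma computable_pair (B C : countType) (f : A -> B) (g : A -> C) :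
  computable P f -> computable P g -> computable P (fun a => (f a, g a)).
Proof.
move=> [rf fP] [rg gP].
exists (comp2 rcode_cons rf (comp2 rcode_cons rg RZero)) => a Pa.
rewrite pickle_pair.
apply: eval_comp2 (fP a Pa) _ (eval_code_cons _ _ _).
exact: eval_comp2 (gP a Pa) (ev_zero _) (eval_code_cons _ _ _).
Qed.

Lemma computable_fst (B C : countType) (f : A -> B * C) :
  computable P f -> computable P (fun a => (f a).1).
Proof.
move=> [rf fP]; exists (comp1 rcode_head rf) => a Pa.
apply: eval_comp1 (fP a Pa) _.
by case: (f a) => b c; rewrite pickle_pair; apply: eval_code_head.
Qed.

Lemma computable_snd (B C : countType) (f : A -> B * C) :
  computable P f -> computable P (fun a => (f a).2).
Proof.
move=> [rf fP]; exists (comp1 rcode_head (comp1 rcode_tail rf)) => a Pa.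
case fa: (f a) (fP a Pa) => [b c]; rewrite pickle_pair => rfa.
apply: eval_comp1 (eval_comp1 rfa (eval_code_tail _ _ _)) _.
exact: eval_code_head.
Qed.

Lemma computable_cons (B : countType) (f : A -> B) (g : A -> seq B) :
  computable P f -> computable P g -> computable P (fun a => f a :: g a).
Proof.
move=> [rf fP] [rg gP]; exists (comp2 rcode_cons rf rg) => a Pa.
rewrite pickle_cons.
exact: eval_comp2 (fP a Pa) (gP a Pa) (eval_code_cons _ _ _).
Qed.

Lemma computable_ifz (B : countType) (n : A -> nat) (f g : A -> B) :
  computable P n -> computable P f ->
  computable (fun a => P a /\ n a <> 0) g ->
  computable P (fun a => if n a == 0 then f a else g a).
Proof.
move=> [rn nP] [rf fP] [rg gP]; exists (rifz rn rf rg) => a Pa.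
rewrite (fun_if pickle); apply: eval_ifz (nP a Pa) (fP a Pa) _.
by move/eqP=> n0; apply: gP.
Qed.

(** Primitive recursion runs for as many rounds as the code of the list; each round pops one
    element, and rounds on the empty list change nothing. The promise of the step includes
    membership in the list, so that a call to the oracle inside a loop can rely on what is known of
    the elements. *)
Lemma computable_foldl (X S : countType) (L : A -> seq X) (z : A -> S)
    (F : A -> S -> X -> S) :
  computable P L -> computable P z ->
  computable (fun t : A * (S * X) => P t.1 /\ t.2.2 \in L t.1)
    (fun t => F t.1 t.2.1 t.2.2) ->
  computable P (fun a => foldl (F a) (z a) (L a)).
Proof.
move=> [rL LP] [rz zP] [rF FP].
(* The loop state is [code_cons] of the remaining list and the accumulator. *)
pose rstep :=
  let a := comp1 rcode_tail (RProj 0) in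
  let rem := comp1 rcode_head (comp1 rcode_head (RProj 0)) in
  let acc := comp1 rcode_tail (comp1 rcode_head (RProj 0)) in
  rifz rem (comp1 rcode_head (RProj 0))
   (comp2 rcode_cons (comp1 rcode_tail rem)
    (comp1 rF (comp2 rcode_cons a
       (comp2 rcode_cons
         (comp2 rcode_cons acc
            (comp2 rcode_cons (comp1 rcode_head rem) RZero)) RZero)))).
pose rloop := RPrec (comp2 rcode_cons rL rz)
  (comp1 rstep (comp2 rcode_cons (RProj 1) (RProj 2))).
exists (comp1 rcode_tail (comp2 rloop rL (RProj 0))) => a Pa.
pose st (s : seq X) y := code_cons (pickle s) (pickle (y : S)).
have evloop n : eval rloop [:: n; pickle a]
    (st (drop n (L a)) (foldl (F a) (z a) (take n (L a)))).
  elim: n => [|n IHn].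
    rewrite drop0 take0; apply/ev_prec0.
    exact: eval_comp2 (LP a Pa) (zP a Pa) (eval_code_cons _ _ _).
  apply: ev_precS IHn _; apply: eval_comp1.
    exact: eval_comp2 (eval_proj1 _ _ _) (eval_proj2 _ _ _ _)
      (eval_code_cons _ _ _).
  set y := foldl _ _ (take n _); set w := code_cons _ _.
  have evst : eval (comp1 rcode_head (RProj 0)) [:: w] (st (drop n (L a)) y).
    exact: eval_comp1 (eval_proj0 _ _) (eval_code_head _ _ _).
  have evrem : eval (comp1 rcode_head (comp1 rcode_head (RProj 0))) [:: w]
      (pickle (drop n (L a))).
    exact: eval_comp1 evst (eval_code_head _ _ _).
  case: (leqP (size (L a)) n) => [le_n | lt_n].
    have dn : drop n (L a) = [::] by rewrite drop_oversize.
    have dn1 : drop n.+1 (L a) = [::] by rewrite drop_oversize // leqW.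
    have yE : y = foldl (F a) (z a) (take n.+1 (L a)).
      by rewrite /y !take_oversize // leqW.
    rewrite -yE dn1 -{1}dn.
    (* The list is exhausted, so the second branch is not run and 0 is an arbitrary value for it. *)
    have := eval_ifz (z := 0) evrem evst; rewrite dn /=.
    by apply.
  have x0 : X by case: (L a) lt_n.
  rewrite (take_nth x0 lt_n) foldl_rcons -/y.
  have := drop_nth x0 lt_n; set x := nth x0 _ _ => dn.
  have n0 : pickle (drop n (L a)) != 0.
    by rewrite dn pickle_cons -lt0n (leq_ltn_trans _ (code_cons_gt _ _)).
  have := eval_ifz (z := st (drop n.+1 (L a)) (F a y x)) evrem evst.
  rewrite (negbTE n0); apply=> _; rewrite dn pickle_cons in evrem.
  apply: eval_comp2 (eval_comp1 evrem (eval_code_tail _ _ _)) _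
    (eval_code_cons _ _ _).
  apply: (eval_comp1 (y := pickle (a, (y, x)))); last first.
    by apply: FP; split; rewrite //= mem_nth.
  rewrite !pickle_pair; apply: eval_comp2 (eval_code_cons _ _ _).
    exact: eval_comp1 (eval_proj0 _ _) (eval_code_tail _ _ _).
  apply: eval_comp2 (ev_zero _) (eval_code_cons _ _ _).
  apply: eval_comp2 (eval_code_cons _ _ _).
    exact: eval_comp1 evst (eval_code_tail _ _ _).
  apply: eval_comp2 (ev_zero _) (eval_code_cons _ _ _).
  exact: eval_comp1 evrem (eval_code_head _ _ _).
apply: eval_comp1 (eval_code_tail (pickle ([::] : seq X)) _ _).
have := evloop (pickle (L a)).
rewrite drop_oversize ?take_oversize ?size_leq_pickle // => evL.
exact: eval_comp2 (LP a Pa) (eval_proj0 _ _) evL.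
Qed.
End Computable.

Lemma eq_computable (A B : countType) (P : A -> Prop) (f g : A -> B) :
  (forall a, P a -> f a = g a) -> computable P f -> computable P g.
Proof. by move=> fg [r rP]; exists r => a Pa; rewrite -fg //; apply: rP. Qed.

(** Pushing elements in a left fold reverses them, so this operation comes first; [rev] and [++]
    follow from it. *)
Lemma computable_catrev (A B : countType) (P : A -> Prop) (f g : A -> seq B) :
  computable P f -> computable P g ->
  computable P (fun a => catrev (f a) (g a)).
Proof.
move=> fP gP.
apply: (@eq_computable _ _ _
  (fun a => foldl (fun s x => x :: s) (g a) (f a))) => [a _|].
  by elim: (f a) (g a) => //= x s IHs z; rewrite IHs.
apply: computable_foldl fP gP _; apply: computable_cons.
  by do 2!apply: computable_snd; apply: computable_id.
by apply/computable_fst/computable_snd/computable_id.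
Qed.

Lemma computable_rev (A B : countType) (P : A -> Prop) (f : A -> seq B) :
  computable P f -> computable P (fun a => rev (f a)).
Proof. by move=> fP; apply: computable_catrev fP (computable_const _). Qed.

Lemma computable_cat (A B : countType) (P : A -> Prop) (f g : A -> seq B) :
  computable P f -> computable P g -> computable P (fun a => f a ++ g a).
Proof.
move=> /computable_rev fP gP; apply: eq_computable (computable_catrev fP gP).
by move=> a _; rewrite catrevE revK.
Qed.

Lemma computable_flatmap (A X Y : countType) (P : A -> Prop) (L : A -> seq X)
    (F : A -> X -> seq Y) :
  computable P L ->
  computable (fun t : A * X => P t.1 /\ t.2 \in L t.1) (fun t => F t.1 t.2) ->
  computable P (fun a => flatten [seq F a x | x <- L a]).
Proof.
move=> LP FP.
apply: (@eq_computable _ _ _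
  (fun a => foldl (fun s x => F a x ++ s) [::] (rev (L a)))) => [a _|].
  by rewrite foldl_rev; elim: (L a) => //= x s ->.
apply: computable_foldl (computable_rev LP) (computable_const _) _.
apply: computable_cat; last exact/computable_fst/computable_snd/computable_id.
apply: (@computable_comp _ _ _ _ _ (fun t => F t.1 t.2)
  (fun t : A * (seq Y * X) => (t.1, t.2.2)) FP) => [|t [Pt]].
  apply: computable_pair; first exact/computable_fst/computable_id.
  exact/computable_snd/computable_snd/computable_id.
by rewrite mem_rev.
Qed.

Lemma computable_map (A X Y : countType) (P : A -> Prop) (L : A -> seq X)
    (F : A -> X -> Y) :
  computable P L ->
  computable (fun t : A * X => P t.1 /\ t.2 \in L t.1) (fun t => F t.1 t.2) ->
  computable P (fun a => [seq F a x | x <- L a]).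
Proof.
move=> LP FP; apply: (@eq_computable _ _ _
  (fun a => flatten [seq [:: F a x] | x <- L a])) => [a _|].
  exact: flatten_map1.
by apply: computable_flatmap LP _;
  apply: computable_cons FP (computable_const _).
Qed.

(** * Candidate facts and saturation *)

Definition db_consts (D : database) : seq nat := flatten [seq f.2 | f <- D].

(** [vs] only provides a length; folding over it brings the enumeration under [computable_foldl]. *)
Definition tuples_like (vs cs : seq nat) : seq (seq nat) :=
  foldl (fun ts _ => flatten [seq [seq c :: t | t <- ts] | c <- cs]) [:: [::]] vs.

Lemma mem_tuples_like vs cs t :
  (t \in tuples_like vs cs) = (size t == size vs) && all (mem cs) t.
Proof.
rewrite /tuples_like -(revK vs) foldl_rev size_rev.
elim: (rev vs) t => [|v ws IHws] t /=; first by case: t.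
apply/flatten_mapP/idP => [[c cs_c] | ].
  case/mapP=> u; rewrite IHws => /andP[/eqP <- us] -> /=.
  by rewrite eqxx us andbT.
case: t => [|c t] //=; rewrite eqSS => /andP[sz /andP[cs_c ts]].
by exists c => //; apply/mapP; exists t; rewrite // IHws sz.
Qed.

(* A candidate (b, (a, t)) proposes the fact with predicate [a.1] and arguments
   [t] as the image of the head atom [a] of a rule with body [b]. *)
Definition candidate := (seq atom * (atom * seq nat))%type.

Definition candidates (D : database) (S : ontology) : seq candidate :=
  flatten [seq flatten [seq [seq (s.1, (a, t)) | t <- tuples_like a.2 (db_consts D)]
                       | a <- s.2] | s <- S].

Lemma candidatesP (D : database) (S : ontology) (k : candidate) :
  reflect (exists s, [/\ s \in S, s.1 = k.1, k.2.1 \in s.2,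
             size k.2.2 = size k.2.1.2 & {subset k.2.2 <= db_consts D}])
    (k \in candidates D S).
Proof.
case: k => b [a t]; apply: (iffP flatten_mapP) => [[s Ss]|[s /= [Ss <- sa sz ts]]].
  case/flatten_mapP=> a' sa' /mapP[t' + [-> -> ->]].
  by rewrite mem_tuples_like => /andP[/eqP sz /allP ts]; exists s.
exists s => //; apply/flatten_mapP; exists a => //; apply/mapP; exists t => //.
by rewrite mem_tuples_like sz eqxx; apply/allP.
Qed.

Section Saturation.
Variable oracle : cert_input -> nat.

(** The rule body is read as a query whose answer variables are the arguments of the head atom. *)
Definition derivable (D : database) (S : ontology) (k : candidate) : bool :=
  oracle (D, S, (k.2.1.2, k.1), k.2.2) != 0.

Definition candidate_fact (k : candidate) : fact := (k.2.1.1, k.2.2).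

Definition add_derivable (S : ontology) (D : database) (k : candidate) :=
  if derivable D S k then candidate_fact k :: D else D.

(** One round per candidate is enough, since a round that starts unsaturated adds a candidate fact.
    Candidates are drawn from the initial database because no round introduces a new constant. *)
Definition saturate (D : database) (S' S : ontology) : database :=
  foldl (fun D' _ => foldl (add_derivable S) D' (candidates D S')) D
    (candidates D S').

End Saturation.

(** * Computability of the saturation *)

Lemma computable_candidates (A : countType) (P : A -> Prop) (D : A -> database)
    (S : A -> ontology) :
  computable P D -> computable P S ->
  computable P (fun a => candidates (D a) (S a)).
Proof.
move=> DP SP; apply: computable_flatmap SP _.
apply: computable_flatmap;
  first exact/computable_snd/computable_snd/computable_id.
apply: computable_map.
  apply: (@computable_foldl _ _ _ _ (fun t : (A * tgd) * atom => t.2.2)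
    (fun=> [:: [::]]) (fun t ts _ =>
      flatten [seq [seq c :: u | u <- ts] | c <- db_consts (D t.1.1)])).
  - exact/computable_snd/computable_snd/computable_id.
  - exact: computable_const.
  apply: computable_flatmap; last first.
    apply: computable_map; last first.
      apply: computable_cons; last exact/computable_snd/computable_id.
      exact/computable_snd/computable_fst/computable_id.
    exact/computable_fst/computable_snd/computable_fst/computable_id.
  apply: computable_flatmap; last first.
    exact/computable_snd/computable_snd/computable_id.
  apply: (computable_comp (f := fun t => t.1.1.1) DP) => [|t [[[]]] //].
  by do 3!apply: computable_fst; apply: computable_id.
apply: computable_pair;
  first exact/computable_fst/computable_snd/computable_fst/computable_fst/
    computable_id.
apply: computable_pair; last exact/computable_snd/computable_id.
exact/computable_snd/computable_fst/computable_id.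
Qed.

Definition dp_input_oracle (oracle : cert_input -> nat) (x : dp_input) : nat :=
  let: (D, (R', R), q, c) := x in oracle (saturate oracle D R' R, R, q, c).

Lemma computable_dp_input_oracle C oracle :
  computable (cert_eval_dom C) oracle ->
  computable (dp_cert_eval_dom C) (dp_input_oracle oracle).
Proof.
move=> oC; apply: (@eq_computable _ _ _ (fun x : dp_input =>
  oracle (saturate oracle x.1.1.1 x.1.1.2.1 x.1.1.2.2, x.1.1.2.2, x.1.2, x.2))).
  by case=> [[[D [R' R]] q] c].
apply: (computable_comp (f := fun x : dp_input =>
    (saturate oracle x.1.1.1 x.1.1.2.1 x.1.1.2.2, x.1.1.2.2, x.1.2, x.2)) oC);
  last by case=> [[[D [R' R]] q] c] [[]].
have DP (Q : dp_input -> Prop) : computable Q (fun x : dp_input => x.1.1.1).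
  exact/computable_fst/computable_fst/computable_fst/computable_id.
have kP (Q : dp_input -> Prop) :
    computable Q (fun x : dp_input => candidates x.1.1.1 x.1.1.2.1).
  apply: computable_candidates => //.
  exact/computable_fst/computable_snd/computable_fst/computable_fst/
    computable_id.
have SP (Q : dp_input -> Prop) : computable Q (fun x : dp_input => x.1.1.2.2).
  exact/computable_snd/computable_snd/computable_fst/computable_fst/
    computable_id.
apply: computable_pair; last exact/computable_snd/computable_id.
apply: computable_pair; last exact/computable_snd/computable_fst/computable_id.
apply: computable_pair => //.
apply: (@computable_foldl _ _ _ _ _ _ (fun (x : dp_input) D' _ =>
  foldl (add_derivable oracle x.1.1.2.2) D' (candidates x.1.1.1 x.1.1.2.1))) => //.
apply: (@computable_foldl _ _ _ _ (fun t => candidates t.1.1.1.1 t.1.1.1.2.1)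
   (fun t : dp_input * (database * candidate) => t.2.1)
   (fun t D' k => add_derivable oracle t.1.1.1.2.2 D' k)).
- apply: (computable_comp (f := fst) (kP (fun=> True))) => //.
  exact/computable_fst/computable_id.
- exact/computable_fst/computable_snd/computable_id.
set Q := (Q in computable Q _).
have S1P (Q' : _ -> Prop) : computable Q'
   (fun t : dp_input * (database * candidate) * (database * candidate) =>
     t.1.1.1.1.2.2).
  apply: (computable_comp (f := fun t => t.1.1) (SP (fun=> True))) => //.
  exact/computable_fst/computable_fst/computable_id.
have D1P (Q' : _ -> Prop) : computable Q'
   (fun t : dp_input * (database * candidate) * (database * candidate) => t.2.1).
  exact/computable_fst/computable_snd/computable_id.
apply: (@eq_computable _ _ _ (fun t =>
  if oracle (t.2.1, t.1.1.1.1.2.2, (t.2.2.2.1.2, t.2.2.1), t.2.2.2.2) == 0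
  then t.2.1 else candidate_fact t.2.2 :: t.2.1)) => [t _|].
  by rewrite /add_derivable /derivable; case: eqP.
apply: computable_ifz => //.
  apply: (computable_comp (f := fun t :
      dp_input * (database * candidate) * (database * candidate) =>
    (t.2.1, t.1.1.1.1.2.2, (t.2.2.2.1.2, t.2.2.1), t.2.2.2.2)) oC).
    apply: computable_pair;
      last exact/computable_snd/computable_snd/computable_snd/computable_snd/
        computable_id.
    apply: computable_pair; first exact: computable_pair.
    apply: computable_pair;
      last exact/computable_fst/computable_snd/computable_snd/computable_id.
    exact/computable_snd/computable_fst/computable_snd/computable_snd/
      computable_snd/computable_id.
  (* The call meets the promise: the ontology is the half in [C], and the candidate tuple has the
     length of the head atom. *)
  move=> [[[[[D [R' R]] q] c] u] [D' k]] [[[[_ CS] _] _] kc].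
  case/candidatesP: kc.
  by move=> s [_ _ _ sz _].
apply: computable_cons => //; apply: computable_pair.
  exact/computable_fst/computable_fst/computable_snd/computable_snd/
    computable_snd/computable_id.
exact/computable_snd/computable_snd/computable_snd/computable_snd/computable_id.
Qed.

(** * The skolem chase and its universality *)

Lemma vars_ofP (As : seq atom) x :
  reflect (exists2 a, a \in As & x \in a.2) (x \in vars_of As).
Proof. exact: flatten_mapP. Qed.

Lemma cert_sub q (D D' : database) S c :
  {subset D <= D'} -> cert q D S c -> cert q D' S c.
Proof. by move=> sDD' cD M MD'; apply: cD => f /sDD'; apply: MD'. Qed.

Notation tree := (GenTree.tree nat).

(* Terms of the skolem chase: leaves are constants, and a node labelled
   [pickle (s, z)] is the null invented for the existential variable z of s at
   the listed images of the body variables of s. *)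
Definition skolem (s : tgd) (h : nat -> tree) (x : nat) : tree :=
  if x \in vars_of s.1 then h x
  else GenTree.Node (pickle (s, x)) [seq h y | y <- vars_of s.1].

Definition value_of_tree (t : tree) : value :=
  if t is GenTree.Leaf c then inl c else inr (pickle t).

Definition tree_of_value (v : value) : tree :=
  match v with
  | inl c => GenTree.Leaf c
  | inr n => odflt (GenTree.Leaf 0) (unpickle n)
  end.

Lemma value_of_treeK : cancel value_of_tree tree_of_value.
Proof. by case=> [c|k ts] //; rewrite /tree_of_value /= pickleK. Qed.

Section Chase.
Variables (D : database) (S : ontology).

Inductive chase : nat * seq tree -> Prop :=
| chase_db f : f \in D -> chase (f.1, [seq GenTree.Leaf c | c <- f.2])
| chase_tgd s h a : s \in S ->
    (forall b, b \in s.1 -> chase (b.1, [seq h x | x <- b.2])) ->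
    a \in s.2 -> chase (a.1, [seq skolem s h x | x <- a.2]).

Definition chase_instance : instance :=
  fun f => exists2 g, chase g & f = (g.1, [seq value_of_tree t | t <- g.2]).

Lemma chase_tree f t : chase f -> t \in f.2 ->
  (exists2 c, c \in db_consts D & t = GenTree.Leaf c) \/
  (exists s z ts, t = GenTree.Node (pickle ((s, z) : tgd * nat)) ts).
Proof.
move=> chf; elim: chf t => {f} [f Df|s h a Ss _ IHs sa] t /= /mapP[x ax ->].
  by left; exists x => //; apply/flatten_mapP; exists f.
rewrite /skolem; case: vars_ofP => [[b sb bx]|_]; last first.
  by right; exists s, x; eexists.
by apply: IHs sb _ _; apply: map_f.
Qed.

(** By induction on the chase, a null at a head position is either invented there, which is the base
    clause of [affected], or copied from a frontier variable that carries it at all its body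
    positions, which is the step clause. *)
Lemma chase_affected (S' : ontology) f i s z ts : {subset S <= S'} ->
  chase f -> i < size f.2 ->
  nth (GenTree.Leaf 0) f.2 i = GenTree.Node (pickle ((s, z) : tgd * nat)) ts ->
  affected S' s z (f.1, size f.2, i).
Proof.
move=> sSS' chf; elim: chf i => {f} [f Df|s' h a Ss _ IHs sa] i /=.
  by rewrite size_map => lti; rewrite (nth_map 0).
rewrite size_map => lti; rewrite (nth_map 0) // /skolem.
set x := nth 0 _ i.
have xhead : x \in vars_of s'.2 by apply/vars_ofP; exists a; rewrite ?mem_nth.
have occ : occurs_at s'.2 x (a.1, size a.2, i) by exists a => //; exists i.
case: ifP => [xbody hx | /negbT xbody []].
  apply: (aff_step (s' := s')) occ _ => //; first exact: sSS'.
  move=> _ [b sb [j [ltj bj ->]]].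
  have := IHs b sb j; rewrite /= size_map (nth_map 0) // bj.
  by apply.
(* The label of the node determines the rule and the variable that invented it. *)
move/(pcan_inj pickleK) => -[<- <- _].
by apply: aff_base occ => //; apply: sSS'.
Qed.

Lemma chase_instance_atom h b : chase_instance (inst_atom h b) ->
  chase (b.1, [seq tree_of_value (h x) | x <- b.2]) /\
  {in b.2, forall x, value_of_tree (tree_of_value (h x)) = h x}.
Proof.
case=> -[p ts] chts [-> hb]; split.
  by rewrite (map_comp tree_of_value h) hb -map_comp (eq_map value_of_treeK) map_id.
move=> x bx; have : h x \in [seq value_of_tree t | t <- ts].
  by rewrite -hb map_f.
by case/mapP=> t _ ->; rewrite value_of_treeK.
Qed.

Lemma chase_instance_db : contains_db chase_instance D.
Proof.
move=> f Df; exists (f.1, [seq GenTree.Leaf c | c <- f.2]).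
  exact: chase_db.
by rewrite -map_comp.
Qed.

Lemma chase_instance_model : is_model chase_instance S.
Proof.
(* The match is pulled back to trees, where the skolem terms of the rule provide its extension. *)
move=> s Ss h hs; pose g x := tree_of_value (h x).
exists (fun x => value_of_tree (skolem s g x)); split=> [x xs | a sa].
  rewrite /skolem xs; case/vars_ofP: xs => b sb bx.
  by have [_ ->] := chase_instance_atom (hs b sb).
exists (a.1, [seq skolem s g x | x <- a.2]); last by rewrite -map_comp.
by apply: chase_tgd => // b sb; have [] := chase_instance_atom (hs b sb).
Qed.

Section Homomorphism.
Variable M : instance.

(** [satisfies] only asserts that an extension exists; fixing one per rule and match makes all nulls
    of one rule application use the same extension. *)
Definition extension (s : tgd) (h : nat -> value) : nat -> value :=
  epsilon (inhabits h) (fun h' =>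
    (forall x, x \in vars_of s.1 -> h' x = h x) /\
    (forall a, a \in s.2 -> M (inst_atom h' a))).

(** The children of a node list the images of the body variables in order, so the match is recovered
    by [index]; [inl 0] is a filler. *)
Fixpoint chase_hom (t : tree) : value :=
  match t with
  | GenTree.Leaf c => inl c
  | GenTree.Node k ts =>
    if unpickle k is Some (s, z) then
      extension s (fun x => nth (inl 0) (map chase_hom ts) (index x (vars_of s.1))) z
    else inl 0
  end.

Hypotheses (MD : contains_db M D) (MS : is_model M S).

Lemma chase_homP f : chase f -> M (f.1, [seq chase_hom t | t <- f.2]).
Proof.
elim=> {f} [f Df|s h a Ss _ IHs sa] /=.
  by rewrite -map_comp; apply: MD.
pose g x := nth (inl 0) [seq chase_hom t | t <- [seq h y | y <- vars_of s.1]]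
  (index x (vars_of s.1)).
have gE : {in vars_of s.1, forall x, g x = chase_hom (h x)}.
  by move=> x xs; rewrite /g -map_comp (nth_map 0) ?index_mem //= nth_index.
have /(MS Ss) ext : forall b, b \in s.1 -> M (inst_atom g b).
  move=> b sb; have := IHs b sb; rewrite /inst_atom /= -map_comp.
  rewrite (_ : map g b.2 = map (chase_hom \o h) b.2) //.
  by apply/eq_in_map => x bx; apply: gE; apply/vars_ofP; exists b.
have [ext_eq extM] : (forall x, x \in vars_of s.1 -> extension s g x = g x) /\
    (forall b, b \in s.2 -> M (inst_atom (extension s g) b)).
  exact: (epsilon_spec (inhabits g) _ ext).
have := extM a sa; rewrite /inst_atom -map_comp.
congr (M (_, _)); apply: eq_map => x /=; rewrite /skolem.
by case: ifP => xs; [rewrite ext_eq // gE | rewrite /= pickleK].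
Qed.

End Homomorphism.

(** [chase_hom] maps the chase into any model and fixes constants, so it carries answers over. *)
Lemma chase_universal q c : answer q chase_instance c -> cert q D S c.
Proof.
move=> [h [hq hc]] M MD MS.
exists (fun x => chase_hom M (tree_of_value (h x))); split=> [b qb|].
  have [chb _] := chase_instance_atom (hq b qb).
  by have := chase_homP MD MS chb; rewrite /= -map_comp.
rewrite (map_comp (fun v => chase_hom M (tree_of_value v)) h) hc.
by rewrite -map_comp.
Qed.

End Chase.

(** * Correctness of the saturation *)

Section Correctness.
Variables (oracle : cert_input -> nat) (S' S : ontology) (D : database).
Hypothesis oracleP : forall D' q c, oracle (D', S, q, c) <> 0 <-> cert q D' S c.

Lemma derivableP D' k :
  reflect (cert (k.2.1.2, k.1) D' S k.2.2) (derivable oracle D' S k).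
Proof.
by apply: (iffP idP) => [/eqP/oracleP //|dk]; apply/eqP/oracleP.
Qed.

Lemma derivable_sub D1 D2 k :
  {subset D1 <= D2} -> derivable oracle D1 S k -> derivable oracle D2 S k.
Proof. by move=> sD /derivableP dk; apply/derivableP/(cert_sub sD). Qed.

Lemma foldl_add_derivable_sub (ks : seq candidate) D' :
  {subset D' <= foldl (add_derivable oracle S) D' ks}.
Proof.
elim: ks D' => [|k ks IHks] D' f D'f //=; apply: IHks; rewrite /add_derivable.
by case: ifP => // _; rewrite inE D'f orbT.
Qed.

(** The database only grows during a round, so [k] is still derivable when its turn comes. *)
Lemma foldl_add_derivable_mem (ks : seq candidate) D' k :
  k \in ks -> derivable oracle D' S k ->
  candidate_fact k \in foldl (add_derivable oracle S) D' ks.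
Proof.
elim: ks D' => //= k' ks IHks D'; rewrite inE => /predU1P[<-|ks_k] dk.
  by apply: foldl_add_derivable_sub; rewrite /add_derivable dk mem_head.
apply: IHks => //; apply: derivable_sub dk => f.
exact: (@foldl_add_derivable_sub [:: k'] D').
Qed.

Definition saturated (ks : seq candidate) (D' : database) : Prop :=
  forall k, k \in ks -> derivable oracle D' S k -> candidate_fact k \in D'.

Lemma foldl_add_derivable_saturated (ks ks' : seq candidate) D' :
  {subset ks' <= ks} -> saturated ks D' ->
  foldl (add_derivable oracle S) D' ks' =i D'.
Proof.
move=> + satD'; elim/last_ind: ks' => // ks' k IHks ks_k f.
rewrite foldl_rcons.
have IH : foldl (add_derivable oracle S) D' ks' =i D'.
  by apply: IHks => k' ks_k'; apply: ks_k; rewrite mem_rcons inE ks_k' orbT.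
rewrite /add_derivable; case: ifP => // dk; rewrite inE IH.
case: eqP => //= ->; apply/esym/satD'.
  by apply: ks_k; rewrite mem_rcons mem_head.
by apply: derivable_sub dk => f'; rewrite IH.
Qed.

Lemma saturated_sub ks D1 D2 : D1 =i D2 -> saturated ks D1 -> saturated ks D2.
Proof.
move=> eqD sat1 k ks_k dk; rewrite -eqD; apply: sat1 => //.
by apply: derivable_sub dk => f; rewrite eqD.
Qed.

(* Every round that does not leave the database saturated accounts for a new
   candidate. *)
Lemma saturated_rounds (ks : seq candidate) (T : Type) (rounds : seq T) D' :
  size ks <= size rounds + count (fun k => candidate_fact k \in D') ks ->
  saturated ks (foldl (fun D1 _ => foldl (add_derivable oracle S) D1 ks) D' rounds).
Proof.
elim: rounds D' => [|r rounds IHr] D' /= le_ks.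
  move=> k ks_k _; apply: (allP (a := fun k => candidate_fact k \in D')) ks_k.
  by rewrite all_count eqn_leq count_size.
set D1 := foldl _ D' ks.
have [satD'|nsat] := classic (saturated ks D').
  have eqD1 : D1 =i D' by apply: foldl_add_derivable_saturated satD'.
  have : saturated ks D1 by apply: saturated_sub satD' => f; rewrite eqD1.
  elim: (rounds) D1 {eqD1} => [|_ rs IHrs] D2 satD2 //=; apply: IHrs.
  apply: (saturated_sub _ satD2) => f.
  by rewrite (foldl_add_derivable_saturated (ks := ks)).
apply: IHr; apply: leq_trans le_ks _; rewrite addSnnS leq_add2l.
have [k ks_k [dk nk]] : exists2 k, k \in ks &
    derivable oracle D' S k /\ candidate_fact k \notin D'.
  apply: NNPP => nk; apply: nsat => k ks_k dk; apply: contraT => nDk.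
  by case: nk; exists k.
(* Old members are counted among the new ones; [k] is new but not old, so the count is strict. *)
rewrite -(@eq_count _ (predI (fun k => candidate_fact k \in D')
    (fun k => candidate_fact k \in D1))) => [|k' /=]; last first.
  case: (boolP (_ \in D')) => //= D'k'; apply: foldl_add_derivable_sub D'k'.
rewrite -count_filter -[ltnRHS]size_filter ltn_neqAle count_size andbT -all_count.
by apply/allPn; exists k; rewrite // mem_filter ks_k foldl_add_derivable_mem.
Qed.

Lemma saturate_saturated :
  saturated (candidates D S') (saturate oracle D S' S).
Proof. by apply: saturated_rounds; apply: leq_addr. Qed.

Lemma saturate_sub : {subset D <= saturate oracle D S' S}.
Proof.
rewrite /saturate; set ks := candidates D S'; move: {2}ks => rounds f Df.
elim/last_ind: rounds => // rs r IHrs; rewrite foldl_rcons.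
exact: foldl_add_derivable_sub IHrs.
Qed.

Lemma saturate_ind (Q : database -> Prop) :
  Q D ->
  (forall D' k, k \in candidates D S' -> derivable oracle D' S k -> Q D' ->
     Q (candidate_fact k :: D')) ->
  Q (saturate oracle D S' S).
Proof.
move=> QD Qcons.
have Qround (ks : seq candidate) D' : {subset ks <= candidates D S'} ->
    Q D' -> Q (foldl (add_derivable oracle S) D' ks).
  elim: ks D' => //= k ks IHks D' sks QD'.
  apply: IHks => [k' ks_k'|]; first by apply: sks; rewrite inE ks_k' orbT.
  rewrite /add_derivable; case: ifP => // dk.
  by apply: Qcons; rewrite ?sks ?mem_head.
rewrite /saturate; set ks := candidates D S'; move: {2}ks => rounds.
by elim/last_ind: rounds => // rs r IHrs; rewrite foldl_rcons; apply: Qround.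
Qed.

Lemma saturate_consts : {subset db_consts (saturate oracle D S' S) <= db_consts D}.
Proof.
apply: (saturate_ind (Q := fun D' => {subset db_consts D' <= db_consts D})) =>
  // D' k /candidatesP[s [_ _ _ _ kD]] _ IH c.
by rewrite /db_consts /= mem_cat => /orP[/kD | /IH].
Qed.

(** A model of all rules over [D] contains each added fact: the body query holds in it, and the rule
    then yields the head. *)
Lemma cert_saturate_sound q c :
  (forall s, s \in S' -> datalog_rule s) ->
  cert q (saturate oracle D S' S) S c -> cert q D (S' ++ S) c.
Proof.
move=> dlS' cq M MD MS.
have MS2 : is_model M S by move=> s Ss; apply: MS; rewrite mem_cat Ss orbT.
apply: cq => //; apply: (saturate_ind (Q := contains_db M)) => // D' k.
case/candidatesP=> s [S's sk sa _ _] /derivableP dk MD' f.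
rewrite inE => /predU1P[-> {f}|]; last exact: MD'.
have [h [hk ht]] := dk M MD' MS2.
have [h' [h'h h's]] : exists h', (forall x, x \in vars_of s.1 -> h' x = h x) /\
    (forall a, a \in s.2 -> M (inst_atom h' a)).
  by apply: MS; rewrite ?sk // mem_cat S's.
rewrite /candidate_fact /= -ht.
(* The rule is datalog, so [h'] agrees with [h] on its only head atom. *)
have [_ [a [sE aS]]] := dlS' s S's; move: sa; rewrite sE inE => /eqP ka.
have := h's a; rewrite sE mem_head => /(_ isT).
rewrite /inst_atom ka (_ : map h' a.2 = map h a.2) //.
by apply/eq_in_map => x ax; apply/h'h/aS.
Qed.

Let Ch := chase_instance (saturate oracle D S' S) S.

(** If [h x] were a null invented for [z], every body position of [x] would be [z]-affected, against
    harmlessness. *)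
Lemma chase_instance_harmless s h x :
  (forall b, b \in s.1 -> Ch (inst_atom h b)) -> x \in vars_of s.1 ->
  harmless (S' ++ S) s x -> exists2 c, c \in db_consts D & h x = inl c.
Proof.
move=> hs xs harm; have /vars_ofP[b sb bx] := xs.
have [chb hE] := chase_instance_atom (hs b sb).
have := chase_tree chb (map_f _ bx) => -[[c /saturate_consts Dc hx]|].
  by exists c => //; rewrite -hE // hx.
move=> [s0 [z [ts hx]]]; case: harm; exists s0, z => _ [b' sb' [i [lti b'i ->]]].
have [chb' _] := chase_instance_atom (hs b' sb').
have sSS : {subset S <= S' ++ S} by move=> s' Ss'; rewrite mem_cat Ss' orbT.
have := chase_affected (i := i) (s := s0) (z := z) (ts := ts) sSS chb'.
by rewrite /= size_map (nth_map 0) // b'i; apply.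
Qed.

Lemma chase_instance_head_ground :
  head_ground S' (S' ++ S) -> is_model Ch (S' ++ S).
Proof.
move=> [dlS' harmS' _ _] s; rewrite mem_cat => /orP[S's|]; last first.
  exact: chase_instance_model.
move=> h hs; exists h; split=> // a sa.
have [_ [a' [sE aS]]] := dlS' s S's.
have {a' sE}aS x : x \in a.2 -> x \in vars_of s.1.
  by move: sa; rewrite sE inE => /eqP ->; apply: aS.
have hc x : x \in a.2 -> exists2 c, c \in db_consts D & h x = inl c.
  move=> ax; apply: chase_instance_harmless hs (aS x ax) _.
  by apply: harmS' => //; apply/vars_ofP; exists a.
(* By [hc] the default 0 is never taken. *)
pose t := [seq (if h x is inl c then c else 0) | x <- a.2].
have ht : map h a.2 = map inl t.
  by rewrite -map_comp; apply/eq_in_map => x /hc[c _ /= ->].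
have ka : (s.1, (a, t)) \in candidates D S'.
  apply/candidatesP; exists s; split=> //=; first by rewrite size_map.
  by move=> _ /mapP[x /hc[c Dc hx] ->]; rewrite hx.
rewrite /inst_atom ht; apply: (@chase_instance_db _ S (a.1, t)).
apply: (saturate_saturated ka); apply/derivableP.
(* The match is an answer in the chase, hence a certain answer, and saturation has put the head fact
   in. *)
by apply: chase_universal; exists h.
Qed.

(** For the converse, certainty is applied to the chase, a model of all rules, and universality
    spreads the answer to every model. *)
Lemma cert_saturate q c : head_ground S' (S' ++ S) ->
  cert q (saturate oracle D S' S) S c <-> cert q D (S' ++ S) c.
Proof.
move=> hg; split; first by apply: cert_saturate_sound; case: hg.
move=> cq; apply: chase_universal; apply: cq.
  by move=> f Df; apply/chase_instance_db/saturate_sub.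
exact: chase_instance_head_ground.
Qed.

End Correctness.

(** * The reduction *)

(** A total function obtained classically; the decision procedure computes it on valid instances. *)
Definition cert_oracle (x : cert_input) : nat :=
  if excluded_middle_informative (cert_eval_yes x) then 1 else 0.

Lemma cert_oracleP (x : cert_input) : cert_oracle x <> 0 <-> cert_eval_yes x.
Proof. by rewrite /cert_oracle; case: excluded_middle_informative. Qed.

Lemma cert_oracle01 (x : cert_input) : cert_oracle x = 0 \/ cert_oracle x = 1.
Proof.
by rewrite /cert_oracle; case: excluded_middle_informative; [right | left].
Qed.

Theorem mainTheorem5 (C : ontology -> Prop)
  (HC : forall S, C S -> wf_ontology S) :
  decidable_on (cert_eval_dom C) cert_eval_yes ->
  decidable_on (dp_cert_eval_dom C) dp_cert_eval_yes.
Proof.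
case=> e eP; have /computable_dp_input_oracle[r rP] :
    computable (cert_eval_dom C) cert_oracle.
  exists e => x /eP[e1 e0]; rewrite /cert_oracle.
  by case: excluded_middle_informative.
exists r => x domx; have := rP x domx.
have : dp_input_oracle cert_oracle x <> 0 <-> dp_cert_eval_yes x.
  case: x domx => [[[D [S' S]] q] c] /= [[hg _] _].
  apply: (iff_trans (cert_oracleP _)); apply: cert_saturate hg => D' q' c'.
  exact: cert_oracleP.
have : dp_input_oracle cert_oracle x = 0 \/ dp_input_oracle cert_oracle x = 1.
  by move: x {domx} => [[[D [S' S]] q] c]; apply: cert_oracle01.
by case=> -> [yes no] evr; split=> [/no | nyes] //; case: nyes; apply: yes.
Qed.
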